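(* In the setting of the context (problem $\min_{x\in\mathcal{M}}F(x)$ with the stated assumptions on $f,h,g$ and on the retraction), let $\{x_j\}$ be the sequence generated by the iRPDC framework described in the context, where at every iteration $j$ the direction $\eta_j$ satisfies the inexactness conditions (a)-(d) and where $\sum_{t=0}^{j}\tau_t\mu_t\le\mu$ for all $j\ge0$. If $\epsilon>0$, then the algorithm terminates within $\mathcal{O}(\epsilon^{-2})$ iterations and returns an $\epsilon$-Riemannian critical point of the problem. (The constant hidden in $\mathcal{O}(\cdot)$ does not depend on $\epsilon$.)
   Context: Setting. $\mathcal{E}$ is a finite-dimensional Euclidean space with inner product $\langle\cdot,\cdot\rangle$ and norm $\|\cdot\|$; $\mathcal{M}\subset\mathcal{E}$ is a Riemannian submanifold with the induced metric; $T_x\mathcal{M}$ is the tangent space and $\mathrm{Proj}_{T_x\mathcal{M}}$ the orthogonal projector onto it. The problem is $\min_{x\in\mathcal{M}}F(x):=f(x)+h(x)-g(x)$. Assumptions on $f,h,g$: $f:\mathcal{E}\to\mathbb{R}$ is smooth, $L_f^0$-Lipschitz, and $f(y)\le f(x)+\langle\nabla f(x),y-x\rangle+\frac{L_f}{2}\|y-x\|^2$ for all $x,y\in\mathcal{E}$; $h,g:\mathcal{E}\to\mathbb{R}$ are convex, possibly nonsmooth, and Lipschitz with parameters $L_h^0,L_g^0$; for some $\bar F\in\mathbb{R}$ the level set $\{x\in\mathcal{M}:F(x)\le\bar F\}$ is compact. (All of $L_f^0,L_f,L_h^0,L_g^0$ are $\ge0$.) Assumption on the retraction: for $x\in\mathcal{M}$,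 $\mathrm{Retr}_x:T_x\mathcal{M}\to\mathcal{M}$ is smooth, globally defined, $\mathrm{Retr}_x(0)=x$, $\frac{d}{dt}\mathrm{Retr}_x(t\eta)|_{t=0}=\eta$, and there are constants $\iota_1,\iota_2>0$ with $\|\mathrm{Retr}_x(\eta)-x\|\le\iota_1\|\eta\|$ and $\|\mathrm{Retr}_x(\eta)-x-\eta\|\le\iota_2\|\eta\|^2$ for all $x\in\mathcal{M}$, $\eta\in T_x\mathcal{M}$. $\epsilon$-Riemannian critical point. $\mathrm{grad} f(x)=\mathrm{Proj}_{T_x\mathcal{M}}(\nabla f(x))$, and $\partial$ is the convex subdifferential. A point $x\in\mathcal{M}$ is an $\epsilon$-Riemannian critical point if there is $y\in\mathcal{E}$ with $\|y-x\|\le\epsilon$ and $\mathrm{dist}\big(0,\ \mathrm{grad} f(x)+\mathrm{Proj}_{T_x\mathcal{M}}(\partial h(y))-\mathrm{Proj}_{T_x\mathcal{M}}(\partial g(x))\big)\le\epsilon$. iRPDC framework. Parameters: $\epsilon>0$, $x_0\in\mathcal{M}$, $\rho\in[0,1)$, $c\in(0,1-\rho/2)$, $s\in(0,1)$, $0<L_{\min}\le L_{\max}$, $\kappa>0$, $\beta_1>0$, $\beta_2\ge0$ with $2(\beta_1\kappa^2+\beta_2)<1$, and constants $\mu\ge0$, $\chi>0$. For $j=0,1,\dots$: 1. Choose $\ell_j\in[L_{\min},L_{\max}]$; put $\epsilon_j=\min\{\ell_j^{-1},1\}\epsilon$; choose $\widetilde\xi_j\in\partial g(x_j)$; put $\xi_j=\mathrm{Proj}_{T_{x_j}\mathcal{M}}(\widetilde\xi_j)$,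 $p_j=\mathrm{grad} f(x_j)-\xi_j$. 2. Let $q_j(\eta)=\langle p_j,\eta\rangle+\frac{\ell_j}{2}\|\eta\|^2+h(x_j+\eta)$ and let $\eta_j^\star$ be its unique minimizer over $T_{x_j}\mathcal{M}$. Find $\eta_j\in T_{x_j}\mathcal{M}$ and reals $\mu_j,\chi_j$ satisfying the inexactness conditions: (a) $q_j(\eta_j)\le q_j(0)-\frac{(1-\rho)\ell_j}{2}\|\eta_j\|^2+\mu_j+c\beta_1\ell_j\epsilon_j^2$; (b) $\|\eta_j^\star\|\le\kappa\|\eta_j\|+(\chi_j+\beta_2\epsilon_j^2)^{1/2}$; (c) $\mu_j\ge-\frac{\rho\ell_j}{2}\|\eta_j\|^2$; (d) $\chi_j\ge0$ and $\sum_{t=0}^{j}\chi_t\le\chi$. 3. If $\kappa\|\eta_j\|+(\chi_j+\beta_2\epsilon_j^2)^{1/2}\le\epsilon_j$, stop and return $x_j$. 4. Let $\tau_j=s^i$ with $i$ the smallest nonnegative integer such that $F(\mathrm{Retr}_{x_j}(\tau_j\eta_j))\le F(x_j)-c\tau_j\ell_j\|\eta_j\|^2+\tau_j(\mu_j+c\beta_1\ell_j\epsilon_j^2)$, and set $x_{j+1}=\mathrm{Retr}_{x_j}(\tau_j\eta_j)$. The hidden constant in $\mathcal{O}(\epsilon^{-2})$ (understood as $\epsilon\to0$) depends only on the problem data, $x_0$, and the parameters other than $\epsilon$ (including $\mu$ and $\chi$, which are fixed independently of $\epsilon$). *)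

(* Defs.v *)
From HB Require Import structures.
From mathcomp Require Export all_boot all_order all_algebra sesquilinear.
From mathcomp Require Export all_classical all_reals all_analysis.
Export Order.TTheory GRing.Theory Num.Theory.
Export numFieldNormedType.Exports.

Set Implicit Arguments.
Unset Strict Implicit.
Unset Printing Implicit Defensive.

#[global] Open Scope classical_set_scope.
#[global] Open Scope ring_scope.

Section Smoothness.
Context (R : realType) (V W : normedModType R).

(* [U] is meant to be open and [V] finite-dimensional: [f] is C^(k+1) on [U]
   iff it is differentiable there with all directional derivatives C^k. *)
Fixpoint C_on (k : nat) (U : set V) (f : V -> W) : Prop :=
  if k is k'.+1 then
    (forall x, U x -> differentiable f x) /\
    (forall v, C_on k' U (fun x => 'D_v f x))
  else forall x, U x -> {for x, continuous f}.

Definition smooth_on (U : set V) (f : V -> W) : Prop := forall k, C_on k U f.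

End Smoothness.

Section Euclidean.
Context (R : realType) (E : normedModType R).

(* The norm of [E] is the one induced by [dot], and [E] has dimension [n]. *)
Definition euclidean_space (dot : {dot E for idfun}) (n : nat) : Prop :=
  (forall x : E, dot x x = `|x| ^+ 2) /\
  exists e : 'I_n -> E, bijective (fun a : 'rV[R]_n => \sum_i a 0 i *: e i).

Context (dot : {dot E for idfun}).

(* When [T] is a linear subspace of a finite-dimensional [E], exactly one [p]
   satisfies the condition. *)
Definition proj (T : set E) (v : E) : E :=
  xget 0 [set p | T p /\ forall w, T w -> dot (v - p) w = 0].

Definition gradient (f : E -> R) (x : E) : E :=
  xget 0 [set p | forall v, dot p v = 'D_v f x].

Definition subdiff (h : E -> R) (x : E) : set E :=
  [set xi | forall y, h x + dot xi (y - x) <= h y].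

(* Extended-real valued, so that the distance to the empty set is +oo. *)
Definition dist0 (S : set E) : \bar R := ereal_inf [set (`|v|)%:E | v in S].

Definition minimizer_on (T : set E) (q : E -> R) (e : E) : Prop :=
  T e /\ forall v, T v -> q e <= q v.

End Euclidean.

Section Submanifold.
Context (R : realType) (E : normedModType R).

(* Embedded C^oo submanifold of dimension [d] of the [n]-dimensional space [E]:
   around each point, a diffeomorphism [phi] (with inverse [psi]) of an open
   subset of [E] onto an open subset of R^n flattens [M] to the slice where the
   coordinates of index >= d vanish. *)
Definition submanifold (n d : nat) (M : set E) : Prop :=
  (d <= n)%N /\
  forall x, M x ->
    exists (U : set E) (V : set 'rV[R]_n) (phi : E -> 'rV[R]_n)
      (psi : 'rV[R]_n -> E),
      [/\ open U, U x & open V] /\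
      [/\ smooth_on U phi, smooth_on V psi,
          (forall y, U y -> V (phi y) /\ psi (phi y) = y) &
          (forall z, V z -> U (psi z) /\ phi (psi z) = z)] /\
      (forall y, U y -> (M y <-> forall i : 'I_n, (d <= i)%N -> phi y 0 i = 0)).

(* Velocities at [x] of smooth curves on [M]. *)
Definition tangent (M : set E) (x : E) : set E :=
  [set v | exists (e : R) (gamma : R -> E),
    [/\ 0 < e, smooth_on `]- e, e[%classic gamma,
        (forall t, `]- e, e[%classic t -> M (gamma t)),
        gamma 0 = x & is_derive (0 : R) (1 : R) gamma v]].

(* [Retr x] is only used on the tangent space at [x], a linear subspace of [E];
   a map on it is smooth iff it extends to a smooth map on [E]. *)
Definition retraction (M : set E) (Retr : E -> E -> E) (iota1 iota2 : R) :
    Prop :=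
  forall x, M x ->
    [/\ (forall eta, tangent M x eta -> M (Retr x eta)),
        (exists G : E -> E, smooth_on setT G /\
          forall eta, tangent M x eta -> G eta = Retr x eta),
        Retr x 0 = x,
        (forall eta, tangent M x eta ->
          is_derive (0 : R) (1 : R) (fun t : R => Retr x (t *: eta)) eta) &
        (forall eta, tangent M x eta ->
          `|Retr x eta - x| <= iota1 * `|eta| /\
          `|Retr x eta - x - eta| <= iota2 * `|eta| ^+ 2)].

Context (dot : {dot E for idfun}) (M : set E) (f h g : E -> R).

Definition rgrad (x : E) : E := proj dot (tangent M x) (gradient dot f x).

Definition critical_point (eps : R) (x : E) : Prop :=
  M x /\ exists y : E, `|y - x| <= eps /\
    (dist0 [set v : E | exists a b, [/\ subdiff dot h y a, subdiff dot g x b &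
       v = rgrad x + proj dot (tangent M x) a - proj dot (tangent M x) b]]%R
     <= eps%:E)%E.

End Submanifold.

Record irpdc_params (R : realType) := IrpdcParams {
  p_rho : R; p_c : R; p_s : R; p_Lmin : R; p_Lmax : R; p_kappa : R;
  p_beta1 : R; p_beta2 : R;
  p_mu : R;  (* bound on the sums of tau_t * mu_t *)
  p_chi : R  (* bound on the sums of chi_t *) }.

Definition valid_params (R : realType) (P : irpdc_params R) : Prop :=
  (0 <= p_rho P < 1) /\ (0 < p_c P < 1 - p_rho P / 2) /\ (0 < p_s P < 1) /\
  (0 < p_Lmin P <= p_Lmax P) /\ 0 < p_kappa P /\
  0 < p_beta1 P /\ 0 <= p_beta2 P /\
  2 * (p_beta1 P * p_kappa P ^+ 2 + p_beta2 P) < 1 /\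
  0 <= p_mu P /\ 0 < p_chi P.

(* [t_xit j] is the element chosen in the subdifferential of [g] at [t_x j],
   before projection; [t_etastar j] is the exact minimizer of the model [qj j].
   Entries at indices that the algorithm does not reach are irrelevant. *)
Record irpdc_trace (R : realType) (E : normedModType R) := IrpdcTrace {
  t_x : nat -> E; t_ell : nat -> R; t_xit : nat -> E; t_etastar : nat -> E;
  t_eta : nat -> E; t_mu : nat -> R; t_chi : nat -> R; t_tau : nat -> R }.

Section Irpdc.
Context (R : realType) (E : normedModType R) (dot : {dot E for idfun}).
Context (M : set E) (f h g : E -> R) (Retr : E -> E -> E).
Context (P : irpdc_params R) (eps : R) (tr : irpdc_trace E).

Local Notation rho := (p_rho P).
Local Notation c := (p_c P).
Local Notation s := (p_s P).
Local Notation Lmin := (p_Lmin P).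
Local Notation Lmax := (p_Lmax P).
Local Notation kappa := (p_kappa P).
Local Notation beta1 := (p_beta1 P).
Local Notation beta2 := (p_beta2 P).
Local Notation x_ := (t_x tr).
Local Notation ell_ := (t_ell tr).
Local Notation xit_ := (t_xit tr).
Local Notation etastar_ := (t_etastar tr).
Local Notation eta_ := (t_eta tr).
Local Notation mu_ := (t_mu tr).
Local Notation chi_ := (t_chi tr).
Local Notation tau_ := (t_tau tr).

Definition objective (z : E) : R := f z + h z - g z.

Definition epsj (j : nat) : R := Num.min (ell_ j)^-1 1 * eps.

Definition pj (j : nat) : E :=
  rgrad dot M f (x_ j) - proj dot (tangent M (x_ j)) (xit_ j).

Definition qj (j : nat) (v : E) : R :=
  dot (pj j) v + ell_ j / 2 * `|v| ^+ 2 + h (x_ j + v).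

Definition errj (j : nat) : R :=
  kappa * `|eta_ j| + Num.sqrt (chi_ j + beta2 * epsj j ^+ 2).

Definition stops (j : nat) : Prop := errj j <= epsj j.

Definition reached (j : nat) : Prop := forall i, (i < j)%N -> ~ stops i.

(* The model [qj j] is strongly convex, so [etastar_ j] is its unique minimizer
   on the tangent space. *)
Definition step12 (j : nat) : Prop :=
  Lmin <= ell_ j <= Lmax /\
  subdiff dot g (x_ j) (xit_ j) /\
  minimizer_on (tangent M (x_ j)) (qj j) (etastar_ j) /\
  tangent M (x_ j) (eta_ j) /\
  (* (a) *)
  qj j (eta_ j) <= qj j 0 - (1 - rho) * ell_ j / 2 * `|eta_ j| ^+ 2
                     + mu_ j + c * beta1 * ell_ j * epsj j ^+ 2 /\
  (* (b) *)
  `|etastar_ j| <= errj j /\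
  (* (c) *)
  mu_ j >= - (rho * ell_ j / 2 * `|eta_ j| ^+ 2) /\
  (* (d) *)
  chi_ j >= 0 /\ \sum_(0 <= t < j.+1) chi_ t <= p_chi P.

Definition decrease (j : nat) (t : R) : Prop :=
  objective (Retr (x_ j) (t *: eta_ j)) <=
    objective (x_ j) - c * t * ell_ j * `|eta_ j| ^+ 2
    + t * (mu_ j + c * beta1 * ell_ j * epsj j ^+ 2).

Definition line_search (j i : nat) : Prop :=
  decrease j (s ^+ i) /\ forall k, (k < i)%N -> ~ decrease j (s ^+ k).

(* The existence of the exponent [i] is not assumed here: that the line search
   succeeds is part of what has to be proved. *)
Definition irpdc_run (x0 : E) : Prop :=
  x_ 0%N = x0 /\
  (forall j, reached j -> step12 j) /\
  (forall j, reached j -> ~ stops j -> forall i, line_search j i ->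
     tau_ j = s ^+ i /\
     x_ j.+1 = Retr (x_ j) (tau_ j *: eta_ j)).

End Irpdc.

(* Main.v *)
Require Import Defs.
From mathcomp Require Import ring lra.

(** Along [t |-> Retr x (t *: eta)] the objective decreases to first order by
   the model decrease, up to an error [C * t ^+ 2 * `|eta| ^+ 2] with [C]
   depending on the Lipschitz constants and the retraction only; so every
   backtracked step [tau] is bounded below, independently of [eps].  As long as
   the method does not stop, [kappa * `|eta|] is at least of order [eps] up to
   the summable [chi], and each iteration decreases the objective by a fixed
   multiple of [eps ^+ 2], up to the summable [tau * mu] and [chi]; the objective
   being bounded below on [M], there are [O(eps ^- 2)] iterations.  At the last
   one, the exact minimizer [e] of the model satisfies [`|e| <= eps], and its
   optimality condition on the tangent space extends by Hahn-Banach to a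
   subgradient [a] of [h] at [x + e], for which
   [rgrad x + proj a - proj xi = - (ell *: e)] has norm at most [eps]. *)

Set Implicit Arguments.
Unset Strict Implicit.
Unset Printing Implicit Defensive.

(** * Projections and subgradients in a finite-dimensional inner product space *)

Section InnerProduct.
Context (R : realType) (E : normedModType R) (dot : {dot E for idfun}).

Lemma dotC u v : dot u v = dot v u.
Proof. by rewrite hermC expr0 mul1r. Qed.

Lemma dotDl u v w : dot (u + v) w = dot u w + dot v w.
Proof. exact: linearDl. Qed.
Lemma dotDr u v w : dot w (u + v) = dot w u + dot w v.
Proof. exact: linearDr. Qed.
Lemma dotNl u w : dot (- u) w = - dot u w.
Proof. exact: linearNl. Qed.
Lemma dotNr u w : dot w (- u) = - dot w u.
Proof. exact: linearNr. Qed.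
Lemma dotBl u v w : dot (u - v) w = dot u w - dot v w.
Proof. exact: linearBl. Qed.
Lemma dotZl a u w : dot (a *: u) w = a * dot u w.
Proof. exact: linearZl_LR. Qed.
Lemma dotZr a u w : dot w (a *: u) = a * dot w u.
Proof. exact: linearZr_LR. Qed.
Lemma dot0l w : dot 0 w = 0.
Proof. exact: linear0l. Qed.
Lemma dot0r w : dot w 0 = 0.
Proof. exact: linear0r. Qed.

Lemma dot_self_eq0 u : dot u u = 0 -> u = 0.
Proof.
move=> u0; apply/eqP; apply/negPn/negP => /(@neq0_dnorm_gt0 _ _ _ dot).
by rewrite u0 ltxx.
Qed.

Definition is_subspace (S : set E) : Prop :=
  [/\ S 0, (forall u v, S u -> S v -> S (u + v)) &
      (forall a u, S u -> S (a *: u))].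

Lemma is_subspaceB S u v : is_subspace S -> S u -> S v -> S (u - v).
Proof. by move=> [_ SD SZ] Su Sv; rewrite -scaleN1r; exact: SD (SZ _ _ _). Qed.

(** Recursion on the generators lets the inductions below remove them one at a time; finite
    dimension is expressed by a list [l] with [spanned l v] for all [v]. *)
Fixpoint spanned (l : seq E) : set E :=
  if l is e :: l' then [set v | exists a, spanned l' (v - a *: e)]
  else [set 0].

Lemma spanned_subspace l : is_subspace (spanned l).
Proof.
elim: l => [|e l [IH0 IHD IHZ]] /=.
  split => //= [u v -> ->|a u ->]; by rewrite ?addr0 ?scaler0.
split => /= [|u v [a ua] [b vb]|a u [b ub]].
- by exists 0; rewrite scale0r subr0.
- by exists (a + b); rewrite scalerDl opprD addrACA; exact: IHD.
- by exists (a * b); rewrite -scalerA -scalerBr; exact: IHZ.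
Qed.

Definition is_proj (S : set E) (v p : E) : Prop :=
  S p /\ forall w, S w -> dot (v - p) w = 0.

(* If [S] meets [span (e :: l)] outside of [span l] in [u], then [S] is the sum
   of [S `&` span l] and the line of [u - P u], [P] being the projection on
   [S `&` span l]. *)
Lemma proj_exists l S v : is_subspace S -> S `<=` spanned l ->
  exists p, is_proj S v p.
Proof.
elim: l S v => [|e l IH] S v hS.
  move=> S0; have [h0 _ _] := hS; exists 0; split => // w /S0 ->.
  by rewrite dot0r.
move=> SE; have [h0 hD hZ] := hS; have hsp := spanned_subspace l.
pose S' := S `&` spanned l.
have hS' : is_subspace S'.
  have [k0 kD kZ] := hsp.
  split => [//|u w [? ?] [? ?]|a u [? ?]]; split;
    by [exact: hD|exact: kD|exact: hZ|exact: kZ].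
have S'l : S' `<=` spanned l by move=> ? [].
have [SS|/existsNP[u /not_implyP[Su nu]]] := pselect (forall u, S u -> spanned l u).
  exact: IH.
have [q [[Sq lq] qo]] := IH _ u hS' S'l.
pose m := u - q.
have [a ua] := SE _ Su.
have a0 : a != 0.
  by apply: contra_notN nu => /eqP a0; move: ua; rewrite a0 scale0r subr0.
have m0 : dot m m != 0.
  apply: contra_notN nu => /eqP /dot_self_eq0 /eqP; rewrite subr_eq0 => /eqP ->.
  exact: lq.
have Sm : S m by exact: is_subspaceB.
have [p [[Sp lp] po]] := IH _ v hS' S'l.
exists (p + (dot v m / dot m m) *: m); split.
  by apply: hD => //; exact: hZ.
move=> w Sw; have [b wb] := SE _ Sw.
(* This multiple of [u] cancels the [e]-component of [w], so that [w'] falls in the span of [l]. *)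
pose w' := w - (b / a) *: u.
have Sw' : S' w'.
  split; first by apply: is_subspaceB => //; exact: hZ.
  have -> : w' = (w - b *: e) - (b / a) *: (u - a *: e).
    by rewrite /w' scalerBr scalerA divfK // opprB addrA subrK.
  by apply: is_subspaceB => //; have [_ _] := hsp; exact.
have -> : w = w' + (b / a) *: q + (b / a) *: m.
  by rewrite -addrA -scalerDr /m [q + _]addrC subrK subrK.
have Sz : S' (w' + (b / a) *: q).
  have [_ +  kZ] := hS'; apply => //; exact: kZ.
have mz := qo _ Sz; rewrite -/m in mz.
have pm : dot p m = 0 by rewrite dotC; exact: qo.
rewrite opprD addrA dotDr dotBl po // dotZl mz mulr0 subr0 add0r dotZr.
by rewrite dotBl (dotBl v p) dotZl pm subr0 divfK // subrr mulr0.
Qed.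

(** * Hahn-Banach extension of subgradients *)

Lemma subspace_line S e : is_subspace S ->
  is_subspace [set v | exists t, S (v - t *: e)].
Proof.
move=> [S0 SD SZ]; split => /= [|u v [t ut] [r vr]|a u [t ut]].
- by exists 0; rewrite scale0r subr0.
- by exists (t + r); rewrite scalerDl opprD addrACA; exact: SD.
- by exists (a * t); rewrite -scalerA -scalerBr; exact: SZ.
Qed.

(** Convexity leaves room for a value [r] at [u] between all lower and all upper slopes of [phi].
    The extended functional stays represented by a vector: a multiple of [u - p], which is
    orthogonal to [S], is added to [a]. *)
Lemma hahn_banach_step (phi : E -> R) (S : set E) a u p :
  (forall x y t, 0 <= t <= 1 ->
     phi (t *: x + (1 - t) *: y) <= t * phi x + (1 - t) * phi y) ->
  is_subspace S -> is_proj S u p -> (forall v, S v -> dot a v <= phi v) ->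
  exists a', (forall v, S v -> dot a' v = dot a v) /\
    forall v t, S v -> dot a' (v + t *: u) <= phi (v + t *: u).
Proof.
move=> phiC hS [Sp up] aphi; have [S0 SD SZ] := hS.
have [m mE] : exists m, m = u - p by exists (u - p).
have [m0|m0] := eqVneq (dot m m) 0.
  have up0 : u = p by apply/eqP; rewrite -subr_eq0 -mE; apply/eqP/dot_self_eq0.
  exists a; split => // v t Sv; apply: aphi; rewrite up0.
  by apply: SD => //; exact: SZ.
pose lower : set R :=
  [set r | exists v t, [/\ S v, 0 < t & r = (dot a v - phi (v - t *: u)) / t]].
have key v1 (t1 : R) v2 (t2 : R) : S v1 -> S v2 -> 0 < t1 -> 0 < t2 ->
    (dot a v1 - phi (v1 - t1 *: u)) / t1 <= (phi (v2 + t2 *: u) - dot a v2) / t2.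
  move=> Sv1 Sv2 t10 t20; rewrite ler_pdivrMr // mulrAC ler_pdivlMr //.
  have t120 : 0 < t1 + t2 by rewrite addr_gt0.
  (* With this weight the multiples of [u] cancel in the convex combination, which leaves a point of
     [S], where [aphi] applies. *)
  pose k := t2 / (t1 + t2).
  have k1 : 1 - k = t1 / (t1 + t2).
    by rewrite /k; field; rewrite gt_eqF.
  have k01 : 0 <= k <= 1.
    by rewrite divr_ge0 ?(ltW t20) ?(ltW t120) //= ler_pdivrMr // mul1r lerDr ltW.
  have := phiC (v1 - t1 *: u) (v2 + t2 *: u) k k01.
  have -> : k *: (v1 - t1 *: u) + (1 - k) *: (v2 + t2 *: u) =
            k *: v1 + (1 - k) *: v2.
    rewrite scalerBr scalerDr !scalerA k1 /k addrACA.
    have -> : t2 / (t1 + t2) * t1 = t1 / (t1 + t2) * t2 by field; rewrite gt_eqF.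
    by rewrite addNr addr0.
  have /aphi : S (k *: v1 + (1 - k) *: v2) by apply: SD; exact: SZ.
  move=> /le_trans /[apply]; rewrite dotDr !dotZr k1 /k.
  move: (phi _) (phi _) (dot a v1) (dot a v2) => P2 P1 A1 A2.
  move: t120; rewrite -invr_gt0; move: (_^-1) => i i0 H.
  have : 0 <= (t2 * P1 + t1 * P2 - t2 * A1 - t1 * A2) * i by lra.
  by rewrite pmulr_lge0 //; lra.
have lower0 : lower !=set0 by exists ((dot a 0 - phi (0 - 1 *: u)) / 1), 0, 1.
have ubl v t : S v -> 0 < t -> ubound lower ((phi (v + t *: u) - dot a v) / t).
  by move=> Sv t0 _ [v1 [t1 [Sv1 t10 ->]]]; exact: key.
have hs : has_sup lower.
  by split => //; exists ((phi (0 + 1 *: u) - dot a 0) / 1); exact: ubl.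
pose r := sup lower.
(* Since [dot m u = dot m m], the coefficient makes the value at [u] equal to [r]. *)
exists (a + ((r - dot a u) / dot m m) *: m).
have mS v : S v -> dot m v = 0 by rewrite mE; exact: up.
have mu : dot m u = dot m m by rewrite -[in LHS](subrK p u) -mE dotDr (mS p) ?addr0.
split => [v Sv|v t Sv]; first by rewrite dotDl dotZl (mS v) // mulr0 addr0.
rewrite dotDl dotZl !dotDr !dotZr (mS v) // add0r mu mulrCA divfK //.
rewrite -addrA -mulrDr [dot a u + _]addrC subrK.
have [t0|t0|->] := ltgtP t 0.
- have : (dot a v - phi (v - (- t) *: u)) / (- t) <= r.
    by apply: ub_le_sup; [case: hs|exists v, (- t); rewrite oppr_gt0].
  rewrite ler_pdivrMr ?oppr_gt0 // scaleNr opprK; lra.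
- have : r <= (phi (v + t *: u) - dot a v) / t by apply: ge_sup => //; exact: ubl.
  rewrite ler_pdivlMr //; lra.
- by rewrite mul0r scale0r !addr0; exact: aphi.
Qed.

(** The list [l] only provides projections; [l'] holds the directions still to be adjoined, and the
    induction on it generalizes [S]. *)
Lemma hahn_banach (phi : E -> R) (l l' : seq E) (S : set E) a :
  (forall x y t, 0 <= t <= 1 ->
     phi (t *: x + (1 - t) *: y) <= t * phi x + (1 - t) * phi y) ->
  (forall v, spanned l v) -> is_subspace S ->
  (forall v, S v -> dot a v <= phi v) ->
  exists a', (forall v, S v -> dot a' v = dot a v) /\
    forall v w, S v -> spanned l' w -> dot a' (v + w) <= phi (v + w).
Proof.
move=> phiC lE; elim: l' S a => [|e l' IH] S a hS aphi.
  by exists a; split => // v _ Sv ->; rewrite addr0; exact: aphi.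
have [p ep] := @proj_exists l S e hS (fun v _ => lE v).
have [a1 [a1S a1phi]] := hahn_banach_step phiC hS ep aphi.
have [|a2 [a2S a2phi]] := IH _ a1 (subspace_line e hS).
  by move=> v [t]; move=> /(a1phi _ t); rewrite subrK.
exists a2; split => [v Sv|v w Sv [t wt]].
  by rewrite a2S ?a1S //; exists 0; rewrite scale0r subr0.
(* The part of [w] along [e] is moved to [v], which then lies in the enlarged subspace. *)
rewrite -(subrK (t *: e) w) addrCA addrC; apply: a2phi.
  by exists t; rewrite addrK.
exact: wt.
Qed.

(** Hahn-Banach for the convex function [h (y + v) - h y] of [v], adjoining generators of all of [E]
    to [T]. *)
Lemma subgradient_extension (h : E -> R) (l : seq E) (T : set E) y b :
  (forall x z t, 0 <= t <= 1 ->
     h (t *: x + (1 - t) *: z) <= t * h x + (1 - t) * h z) ->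
  (forall v, spanned l v) -> is_subspace T ->
  (forall v, T v -> dot b v <= h (y + v) - h y) ->
  exists a, subdiff dot h y a /\ forall v, T v -> dot a v = dot b v.
Proof.
move=> hC lE hT bh.
have [|a [aT ah]] := @hahn_banach (fun v => h (y + v) - h y) l l T b _ lE hT bh.
  move=> u v t t01; have := hC (y + u) (y + v) t t01.
  rewrite !scalerDr addrACA -scalerDl [t + _]addrC subrK scale1r; lra.
exists a; split => // z /=; have [T0 _ _] := hT.
by have := ah 0 (z - y) T0 (lE _); rewrite add0r [y + _]addrC subrK; lra.
Qed.

(** * The projection [proj] and first-order optimality *)

Lemma proj_spec (l : seq E) (T : set E) v :
  (forall u, spanned l u) -> is_subspace T -> is_proj T v (proj dot T v).
Proof.
move=> lE hT; apply: (@xgetPex _ 0 [set p | is_proj T v p]).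
exact: (@proj_exists l T v hT (fun u _ => lE u)).
Qed.

Lemma proj_eq (l : seq E) (T : set E) v b :
  (forall u, spanned l u) -> is_subspace T -> T b ->
  (forall w, T w -> dot v w = dot b w) -> proj dot T v = b.
Proof.
move=> lE hT Tb vb.
have [] := proj_spec v lE hT; set p := proj _ _ _ => Tp vp.
have Tpb : T (p - b) by exact: is_subspaceB.
apply/eqP; rewrite -subr_eq0; apply/eqP/dot_self_eq0.
have := vp _ Tpb; have := vb _ Tpb; rewrite !dotBl; lra.
Qed.

Lemma dot_proj (l : seq E) (T : set E) v w :
  (forall u, spanned l u) -> is_subspace T -> T w ->
  dot (proj dot T v) w = dot v w.
Proof.
move=> lE hT Tw; have [_ /(_ _ Tw)] := proj_spec v lE hT.
by rewrite dotBl; lra.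
Qed.

Lemma ge0_affine_at0 (A B : R) :
  (forall t, 0 < t <= 1 -> 0 <= A + t * B) -> 0 <= A.
Proof.
move=> H; apply/ler_addgt0Pr => e e0.
(* The chosen [t] makes [t * B] at most [e]; the added 1 covers [B = 0]. *)
have B0 : 0 < `|B| + 1 by rewrite ltr_wpDl.
have t0 : 0 < Num.min 1 (e / (`|B| + 1)) by rewrite lt_min ltr01 divr_gt0.
apply: le_trans (H (Num.min 1 (e / (`|B| + 1))) _) _.
  by rewrite t0 ge_min lexx.
rewrite lerD2l; apply: (@le_trans _ _ (Num.min 1 (e / (`|B| + 1)) * (`|B| + 1))).
  by rewrite ler_pM2l // (le_trans (ler_norm _)) // lerDl.
by rewrite -ler_pdivlMr // ge_min lexx orbT.
Qed.

Hypothesis dotE : forall x : E, dot x x = `|x| ^+ 2.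

(* First-order condition along [t *: v] with [t -> 0+], the quadratic term
   being of order [t ^+ 2]. *)
Lemma model_minimizer (h : E -> R) (T : set E) x p ell e :
  (forall x z t, 0 <= t <= 1 ->
     h (t *: x + (1 - t) *: z) <= t * h x + (1 - t) * h z) ->
  is_subspace T ->
  minimizer_on T (fun v => dot p v + ell / 2 * `|v| ^+ 2 + h (x + v)) e ->
  forall v, T v -> dot (- (p + ell *: e)) v <= h (x + e + v) - h (x + e).
Proof.
move=> hC [T0 TD TZ] [Te emin] v Tv.
rewrite dotNl dotDl dotZl -subr_ge0.
apply: (@ge0_affine_at0 _ (ell / 2 * dot v v)) => t /andP[t0 t1].
have := emin (e + t *: v) (TD _ _ Te (TZ _ _ Tv)).
have := hC (x + e + v) (x + e) t; rewrite (ltW t0) t1 => /(_ isT).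
have -> : t *: (x + e + v) + (1 - t) *: (x + e) = x + (e + t *: v).
  by rewrite scalerDr addrAC -scalerDl [t + _]addrC subrK scale1r -addrA.
rewrite -!dotE !(dotDl, dotDr, dotZl, dotZr) (dotC v e) => H1 H2.
rewrite -(pmulr_rge0 _ t0); lra.
Qed.

Lemma spanned_sum (I : Type) (s : seq I) (e : I -> E) (a : I -> R) :
  spanned [seq e i | i <- s] (\sum_(i <- s) a i *: e i).
Proof.
elim: s => [|i s IH] /=; first by rewrite big_nil.
by exists (a i); rewrite big_cons addrC addKr.
Qed.

End InnerProduct.

Lemma euclidean_spanned (R : realType) (E : normedModType R)
    (dot : {dot E for idfun}) (n : nat) :
  euclidean_space dot n -> exists l : seq E, forall v, spanned l v.
Proof.
move=> [_ [e [b _ bK]]]; exists [seq e i | i <- index_enum 'I_n] => v.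
rewrite -(bK v); exact: spanned_sum.
Qed.

(** * Tangent spaces of a submanifold *)

(** The derivative of the restriction in direction [v] is the restriction to the same line of the
    derivative of [f] in direction [v *: w], so the induction on [k] closes without a higher-order
    chain rule. *)
Lemma C_on_line (R : realType) (V W : normedModType R) k (f : V -> W)
    (U : set V) (a w : V) (I : set R) :
  (forall t, I t -> U (a + t *: w)) -> C_on k U f ->
  C_on k I (fun t : R => f (a + t *: w)).
Proof.
have dl (t : R) : differentiable (fun t : R => a + t *: w) t by [].
move=> IU; elim: k f => [|k IH] f /= => [fU t It|[fd fD]].
  apply: (@continuous_comp _ _ _ (fun t : R => a + t *: w)); last exact: fU (IU _ It).
  exact/differentiable_continuous.
split => [t It|v].
  apply: (@differentiable_comp _ _ _ _ (fun t : R => a + t *: w)) => //.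
  by apply: fd; exact: IU.
have -> : (fun x : R => 'D_v (fun t : R => f (a + t *: w)) x) =
          (fun t => 'D_(v *: w) f (a + t *: w)).
  apply/funext => t; rewrite /derive.
  set g1 := fun h => h^-1 *: _; set g2 := fun h => h^-1 *: _.
  suff -> : g1 = g2 by [].
  apply/funext => h; rewrite /g1 /g2 /=.
  by rewrite scalerDl addrCA scalerA.
exact: (IH _ (fD (v *: w))).
Qed.

Section TangentChart.
Context (R : realType) (E : normedModType R) (n d : nat) (M : set E).
Context (x : E) (U : set E) (V : set 'rV[R]_n) (phi : E -> 'rV[R]_n)
  (psi : 'rV[R]_n -> E).
Hypotheses (Uo : open U) (Ux : U x) (Vo : open V) (Mx : M x)
  (phiS : smooth_on U phi) (psiS : smooth_on V psi)
  (phiV : forall y, U y -> V (phi y) /\ psi (phi y) = y)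
  (psiU : forall z, V z -> U (psi z) /\ phi (psi z) = z)
  (MU : forall y, U y -> (M y <-> forall i : 'I_n, (d <= i)%N -> phi y 0 i = 0)).

Let phid : differentiable phi x.
Proof. by have [+ _] := phiS 1; apply. Qed.

(** For a curve on [M], the last coordinates of [phi \o gamma] vanish near 0, hence so do their
    derivatives. Conversely, [psi] sends the straight line through [phi x] with velocity
    ['d phi x v] to a curve on [M] with velocity [v]. Linearity of the tangent space follows from
    this description. *)
Lemma tangent_chart v :
  tangent M x v <-> forall i : 'I_n, (d <= i)%N -> 'd phi x v 0 i = 0.
Proof.
split.
  move=> [e [gamma [e0 _ gM gx [gd gv]]]] i di.
  have gD : differentiable gamma 0 by apply/derivable1_diffP.
  have pgD : differentiable (phi \o gamma) 0.
    by apply: differentiable_comp => //; rewrite gx.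
  have : 'D_1 (phi \o gamma) 0 = 'd phi x v.
    rewrite deriveE // diff_comp ?gx //=.
    by rewrite -gv deriveE.
  move=> <-; rewrite derive_mx ?mxE; last exact: diff_derivable.
  rewrite -[RHS](derive_cst (0 : R) (0 : R) (1 : R)).
  apply: near_eq_derive; near=> t => /=.
  apply: (MU _).1 => //.
    near: t; apply: (differentiable_continuous gD).
    by rewrite gx; exact: open_nbhs_nbhs.
  apply: gM; near: t; apply: near_in_itvoo.
  by rewrite in_itv /= oppr_lt0 e0.
move=> vd; set w := 'd phi x v.
have psid : differentiable psi (phi x).
  by have [+ _] := psiS 1; apply; exact: (phiV Ux).1.
have lc : {for 0, continuous (fun t : R => phi x + t *: w)}.
  exact/differentiable_continuous.
have : \forall t \near (0 : R), V (phi x + t *: w).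
  apply: lc; rewrite scale0r addr0; apply: open_nbhs_nbhs; split => //.
  exact: (phiV Ux).1.
move=> /nbhs_ballP[e /= e0 eV].
have eV' t : `]- e, e[%classic t -> V (phi x + t *: w).
  rewrite /= in_itv /= => te; apply: eV.
  by rewrite /ball /= sub0r normrN ltr_norml.
exists e, (fun t => psi (phi x + t *: w)); split => //.
- by move=> k; exact: C_on_line eV' (psiS k).
- move=> t /eV' Vt; have [Ut pt] := psiU Vt.
  apply/(MU Ut) => i di; rewrite pt !mxE vd // mulr0 addr0.
  exact: (MU Ux).1.
- by rewrite scale0r addr0; exact: (phiV Ux).2.
- have dd : differentiable (fun t : R => psi (phi x + t *: w)) 0.
    apply: (@differentiable_comp _ _ _ _ (fun t : R => phi x + t *: w) psi) => //.
    by rewrite scale0r addr0.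
  apply: DeriveDef; first exact: diff_derivable.
  have -> : 'D_1 (fun t : R => psi (phi x + t *: w)) 0 = 'D_w psi (phi x).
    rewrite /derive.
    set g1 := fun h => h^-1 *: _; set g2 := fun h => h^-1 *: _.
    suff -> : g1 = g2 by [].
    apply/funext => h; rewrite /g1 /g2 /=.
    by rewrite addr0 scale0r !addr0 [_%:A]mulr1 [phi x + _]addrC.
  rewrite deriveE //.
  (* Near [x] the composite [psi \o phi] is the identity, so this derivative is [v]. *)
  have -> : 'd psi (phi x) w = 'd (psi \o phi) x v by rewrite (diff_comp phid psid).
  rewrite -deriveE; last exact: differentiable_comp.
  rewrite -[RHS](derive_id x v); apply: near_eq_derive.
  near=> y => /=; apply: (phiV _).2; near: y.
  exact: open_nbhs_nbhs.
Unshelve. all: by end_near. Qed.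

End TangentChart.

Lemma tangent_subspace (R : realType) (E : normedModType R) (n d : nat)
    (M : set E) x : submanifold n d M -> M x -> is_subspace (tangent M x).
Proof.
move=> [_ MC] Mx.
have [U [V [phi [psi [[Uo Ux Vo] [[phiS psiS phiV psiU] MU]]]]]] := MC x Mx.
have T := tangent_chart Uo Ux Vo Mx phiS psiS phiV psiU MU.
split => [|u v /T uT /T vT|a u /T uT]; apply/T => i di.
- by rewrite linear0 mxE.
- by rewrite linearD mxE uT // vT // addr0.
- by rewrite linearZ mxE uT // mulr0.
Qed.

(** * The inexact Riemannian proximal method *)

Section Functions.
Context (R : realType) (E : normedModType R) (dot : {dot E for idfun}).

Lemma lipschitz_le (L : R) (f : E -> R) : L.-lipschitz f ->
  forall x y, f x - f y <= L * `|x - y|.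
Proof.
move=> fL x y; apply: le_trans (ler_norm _) _.
by have := fL (x, y); apply; split.
Qed.

Lemma convex_function_le (h : E -> R) : convex_function setT h ->
  forall x z t, 0 <= t <= 1 ->
    h (t *: x + (1 - t) *: z) <= t * h x + (1 - t) * h z.
Proof.
move=> hh x z t /andP[t0 t1].
by have := hh (Itv01 t0 t1) x z; rewrite !inE; apply.
Qed.

(** Difference quotients of [f] along [v] are at most [L] times the norm of [v]; the default value 0
    of [xget] satisfies the bound as well. *)
Lemma gradient_lipschitz_le (f : E -> R) (L : R) x v :
  differentiable f x -> 0 <= L -> L.-lipschitz f -> dot (gradient dot f x) v <= L * `|v|.
Proof.
move=> fd L0 fL; rewrite /gradient; case: xgetP => [p _ /= ->|_]; last first.
  by rewrite dot0l mulr_ge0.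
apply: limr_le; first exact: diff_derivable.
near=> t => /=.
have t0 : t != 0 by near: t; exact: nbhs_dnbhs_neq.
apply: le_trans (ler_norm _) _.
rewrite normrZ normfV ler_pdivrMl ?normr_gt0 //.
have := fL (t *: v + x, x); rewrite /= addrK normrZ => H.
by apply: le_trans (H _) _; rewrite // mulrCA.
Unshelve. all: by end_near. Qed.

(** Outside the level set [Fbar] is a lower bound; the level set lies in a ball of radius [B], where
    the Lipschitz constants allow comparison with the value at 0. *)
Lemma objective_bounded_below (f h g : E -> R) (Lf Lh Lg Fbar : R) (M : set E) :
  Lf.-lipschitz f -> Lh.-lipschitz h -> Lg.-lipschitz g ->
  0 <= Lf -> 0 <= Lh -> 0 <= Lg ->
  compact [set x | M x /\ objective f h g x <= Fbar] ->
  exists Fmin, forall x, M x -> Fmin <= objective f h g x.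
Proof.
move=> fL hL gL Lf0 Lh0 Lg0 /compact_bounded [b [_ /(_ (b + 1)) HB]].
have {}HB := HB (ltr_pwDr ltr01 (lexx b)); set B := b + 1 in HB.
exists (Num.min Fbar (objective f h g 0 - (Lf + Lh + Lg) * B)) => x Mx.
have [xF|xF] := leP (objective f h g x) Fbar; last by rewrite ge_min (ltW xF).
rewrite ge_min; apply/orP; right.
have xB : `|x| <= B by apply: HB.
have := lipschitz_le fL 0 x; have := lipschitz_le hL 0 x.
have := lipschitz_le gL x 0; rewrite sub0r subr0 normrN /objective.
have := ler_wpM2l Lf0 xB; have := ler_wpM2l Lh0 xB; have := ler_wpM2l Lg0 xB.
lra.
Qed.

End Functions.

Lemma exists_expr_le (R : realType) (s t : R) : 0 < s < 1 -> 0 < t ->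
  exists i, s ^+ i <= t.
Proof.
move=> /andP[s0 s1] t0.
have /cvgrPdist_le /(_ t t0) [N _ HN] : geometric 1 s x @[x --> \oo] --> 0.
  by apply: cvg_geometric; rewrite ger0_norm // ltW.
exists N; have := HN N (leqnn N).
by rewrite /= mul1r sub0r normrN ger0_norm // exprn_ge0 // ltW.
Qed.

Lemma nat_least (Q : nat -> Prop) : (exists n, Q n) ->
  exists n, Q n /\ forall k, (k < n)%N -> ~ Q k.
Proof.
move=> [n Qn].
have ex : exists n, `[< Q n >] by exists n; apply/asboolP.
case: (ex_minnP ex) => m /asboolP Qm mmin; exists m; split => // k km /asboolP Qk.
by have := mmin _ Qk; rewrite leqNgt km.
Qed.

(** * Descent along the retraction *)

Section Method.
Context (R : realType) (E : normedModType R) (dot : {dot E for idfun}).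
Context (l : seq E) (M : set E) (f h g : E -> R) (Lf0 Lf Lh0 Lg0 : R).
Context (Retr : E -> E -> E) (iota1 iota2 : R).
Hypotheses (dotE : forall x : E, dot x x = `|x| ^+ 2)
  (lE : forall v : E, spanned l v)
  (TM : forall x, M x -> is_subspace (tangent M x))
  (hL : [/\ 0 <= Lf0, 0 <= Lf, 0 <= Lh0 & 0 <= Lg0])
  (fD : forall x, differentiable f x)
  (hf0 : Lf0.-lipschitz f)
  (hfL : forall x y : E,
     f y <= f x + dot (gradient dot f x) (y - x) + Lf / 2 * `|y - x| ^+ 2)
  (hh : convex_function setT h)
  (hh0 : Lh0.-lipschitz h)
  (hg0 : Lg0.-lipschitz g)
  (hiota : 0 < iota1 /\ 0 < iota2)
  (hRetr : retraction M Retr iota1 iota2).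

(** The first term comes from the quadratic upper bound on [f], the second from the retraction
    error, charged to the three Lipschitz constants. *)
Definition curvature_bound : R := Lf / 2 * iota1 ^+ 2 + (Lf0 + Lh0 + Lg0) * iota2.

Lemma curvature_bound_ge0 : 0 <= curvature_bound.
Proof.
have [? ? ? ?] := hL; have [? ?] := hiota.
by apply: addr_ge0; apply: mulr_ge0; rewrite ?sqr_ge0 ?divr_ge0 ?addr_ge0 // ltW.
Qed.

Local Notation F := (objective f h g).

(** The displacement is [t *: eta + r] with [r] of second order. Its linear part is handled by the
    quadratic bound for [f], the subgradient [xi] for [g] and convexity of [h] between [x] and
    [x + eta]. *)
Lemma retraction_descent x xi eta (t : R) : M x -> tangent M x eta ->
  subdiff dot g x xi -> 0 <= t <= 1 ->
  F (Retr x (t *: eta)) <= F x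
    + t * (dot (rgrad dot M f x - proj dot (tangent M x) xi) eta
           + h (x + eta) - h x)
    + curvature_bound * t ^+ 2 * `|eta| ^+ 2.
Proof.
move=> Mx Teta xig t01; have /andP[t0 t1] := t01.
have [Lf00 Lf_0 Lh00 Lg00] := hL; have [i10 i20] := hiota.
have [T0 TD TZ] := TM Mx.
have Tte : tangent M x (t *: eta) by exact: TZ.
have [_ _ _ _ /(_ _ Tte) [H1 H2]] := hRetr Mx.
set y := Retr x (t *: eta) in H1 H2 *.
rewrite normrZ ger0_norm // in H1 H2.
set r := y - x - t *: eta in H2.
have yE : y = x + t *: eta + r by rewrite [RHS]addrC /r -[y - x - _]addrA -opprD subrK.
have yxE : y - x = t *: eta + r by rewrite [RHS]addrC /r subrK.
set G := gradient dot f x.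
have fr : dot G (y - x) <= t * dot G eta + Lf0 * (iota2 * (t * `|eta|) ^+ 2).
  rewrite yxE dotDr dotZr lerD2l.
  apply: le_trans (gradient_lipschitz_le _ _ (fD x) Lf00 hf0) _.
  exact: ler_wpM2l.
have gr : - (dot xi (y - x)) <= - t * dot xi eta + Lg0 * (iota2 * (t * `|eta|) ^+ 2).
  rewrite yxE dotDr dotZr opprD mulNr lerD2l.
  (* The subgradient inequality tested at [x - r], with the Lipschitz bound on [g], controls
     [- dot xi r]. *)
  have := xig (x - r); rewrite /= [x - r]addrC addrK dotNr => H3.
  have := lipschitz_le hg0 (x - r) x; rewrite [x - r]addrC addrK normrN.
  have := ler_wpM2l Lg00 H2; lra.
have hr : h y <= h (x + t *: eta) + Lh0 * (iota2 * (t * `|eta|) ^+ 2).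
  have := lipschitz_le hh0 y (x + t *: eta).
  rewrite {2}yE [_ + r]addrC addrK; have := ler_wpM2l Lh00 H2; lra.
have hc : h (x + t *: eta) <= t * h (x + eta) + (1 - t) * h x.
  rewrite -(_ : t *: (x + eta) + (1 - t) *: x = x + t *: eta).
    exact: convex_function_le.
  by rewrite scalerDr addrAC -scalerDl [t + _]addrC subrK scale1r.
have gc := xig y; rewrite /= in gc.
have fc := hfL x y; rewrite -/G in fc.
have H1sq : `|y - x| ^+ 2 <= (iota1 * (t * `|eta|)) ^+ 2.
  by rewrite ler_sqr ?nnegrE // mulr_ge0 ?(ltW i10) // mulr_ge0.
have {}H1sq := ler_wpM2l (divr_ge0 Lf_0 (ler0n _ 2)) H1sq.
rewrite dotBl /rgrad !(dot_proj dot _ lE (TM Mx) Teta) -/G.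
have -> : curvature_bound * t ^+ 2 * `|eta| ^+ 2 =
  Lf / 2 * (iota1 * (t * `|eta|)) ^+ 2
  + Lf0 * (iota2 * (t * `|eta|) ^+ 2) + Lh0 * (iota2 * (t * `|eta|) ^+ 2)
  + Lg0 * (iota2 * (t * `|eta|) ^+ 2) by rewrite /curvature_bound; ring.
rewrite /objective; lra.
Qed.

(** * Line search, stopping test and progress of a run *)

Section Run.
Context (P : irpdc_params R) (x0 : E) (eps : R) (tr : irpdc_trace E).
Hypotheses (hP : valid_params P) (eps0 : 0 < eps).

Local Notation rho := (p_rho P).
Local Notation c := (p_c P).
Local Notation s := (p_s P).
Local Notation Lmin := (p_Lmin P).
Local Notation Lmax := (p_Lmax P).
Local Notation kappa := (p_kappa P).
Local Notation beta1 := (p_beta1 P).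
Local Notation beta2 := (p_beta2 P).
Local Notation x_ := (t_x tr).
Local Notation ell_ := (t_ell tr).
Local Notation eta_ := (t_eta tr).
Local Notation mu_ := (t_mu tr).
Local Notation chi_ := (t_chi tr).
Local Notation tau_ := (t_tau tr).
Local Notation step := (step12 dot M f h g P eps tr).

(** Below this threshold the second-order error fits in the gap between the model decrease rate
    [1 - rho / 2] and the required rate [c]. The cap 1 is for convexity of [h]; the added 1 keeps
    the denominator positive. *)
Definition safe_step : R :=
  Num.min 1 ((1 - rho / 2 - c) * Lmin / (curvature_bound + 1)).

Lemma safe_step_gt0 : 0 < safe_step.
Proof.
have [_ [/andP[_ cr] [_ [/andP[L0 _] _]]]] := hP.
rewrite lt_min ltr01 divr_gt0 ?mulr_gt0 ?subr_gt0 //.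
by rewrite ltr_wpDl // curvature_bound_ge0.
Qed.

Lemma safe_step_decrease j (t : R) : M (x_ j) -> step j -> 0 < t -> t <= safe_step ->
  decrease f h g Retr P eps tr j t.
Proof.
move=> Mx [/andP[Ll _] [xig [_ [Teta [ha _]]]]] t0.
have C0 := curvature_bound_ge0.
rewrite le_min ler_pdivlMr ?ltr_wpDl // => /andP[t1 tC].
have [_ [/andP[_ cr] _]] := hP.
apply: le_trans (retraction_descent Mx Teta xig _) _; first by rewrite (ltW t0).
move: ha; rewrite /qj dot0r normr0 expr0n /= mulr0 addr0 add0r addr0 -/(pj _ _ _ _ _).
set A := dot _ _; set B := c * beta1 * _ * _; set e := `|_| ^+ 2.
have e0 : 0 <= e by exact: sqr_ge0.
set hx := h (x_ j); set hy := h (x_ j + _) => ha.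
(* The proximal term of [qj] contributes a further [ell_ j / 2 * e], which turns [(1 - rho) / 2]
   into [1 - rho / 2]. *)
have {ha} : A + hy - hx <= - ((1 - rho / 2) * ell_ j * e) + mu_ j + B by lra.
move=> /(ler_wpM2l (ltW t0)) ha.
have key : curvature_bound * t <= (1 - rho / 2 - c) * ell_ j.
  apply: (@le_trans _ _ ((1 - rho / 2 - c) * Lmin)); first lra.
  by rewrite ler_wpM2l // subr_ge0 ltW.
have := ler_wpM2l (mulr_ge0 (ltW t0) e0) key.
lra.
Qed.

Lemma line_search_exists j : M (x_ j) -> step j ->
  exists i, line_search f h g Retr P eps tr j i.
Proof.
move=> Mx hj; have [_ [_ [s01 _]]] := hP; have /andP[s0 _] := s01.
apply: nat_least; have [i hi] := exists_expr_le s01 safe_step_gt0.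
by exists i; apply: safe_step_decrease => //; rewrite exprn_gt0.
Qed.

(** Either the first trial step 1 is accepted, or the trial before the accepted one failed and hence
    exceeded [safe_step]. *)
Lemma line_search_lower_bound j i : M (x_ j) -> step j ->
  line_search f h g Retr P eps tr j i -> s * safe_step <= s ^+ i.
Proof.
move=> Mx hj [_ hi]; have [_ [_ [/andP[s0 s1] _]]] := hP.
case: i hi => [_|i /(_ i (ltnSn _)) hi].
  rewrite expr0; apply: (@le_trans _ _ s); last exact: ltW.
  by rewrite ger_pMr // ge_min lexx.
rewrite exprS ler_pM2l // leNgt; apply/negP => /ltW hs.
by apply: hi; apply: safe_step_decrease => //; rewrite exprn_gt0.
Qed.

Lemma epsj_le j : epsj eps tr j <= eps.
Proof. by rewrite /epsj ger_pMl // ge_min lexx orbT. Qed.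

Lemma stop_critical j : M (x_ j) -> step j -> stops P eps tr j ->
  critical_point dot M f h g eps (x_ j).
Proof.
move=> Mx [/andP[Ll _] [xig [hmin [_ [_ [hb _]]]]]] hs; split => //.
have [_ [_ [_ [/andP[L0 _] _]]]] := hP.
have l0 : 0 < ell_ j by exact: lt_le_trans Ll.
have hT := TM Mx; have [T0 TD TZ] := hT; have [Te _] := hmin.
have es : `|t_etastar tr j| <= epsj eps tr j by exact: le_trans hs.
set e := t_etastar tr j in hb es hmin Te *.
have [a [ah aT]] := subgradient_extension (convex_function_le hh) lE hT
  (model_minimizer dotE (convex_function_le hh) hT hmin).
exists (x_ j + e); split.
  by rewrite [x_ j + e]addrC addrK (le_trans es) // epsj_le.
pose v := - (ell_ j *: e).
(* The vector on the right is tangent and has the same inner products as [a] with tangent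
   vectors. *)
have pa : proj dot (tangent M (x_ j)) a = - (pj dot M f tr j + ell_ j *: e).
  apply: (proj_eq lE hT) => //.
  rewrite -scaleN1r; apply/TZ/TD; last exact: TZ.
  by apply: is_subspaceB => //; apply: (proj_spec _ _ lE hT).1.
apply: (@le_trans _ _ (`|v|)%:E).
  apply: ereal_inf_lbound; exists v => //; exists a, (t_xit tr j); split => //.
  rewrite pa /v /pj opprD opprB; set u := rgrad _ _ _ _; set w := proj _ _ _.
  by rewrite [w - u]addrC addrA addNKr addrAC subrr sub0r.
rewrite lee_fin normrN normrZ gtr0_norm //.
apply: (le_trans (ler_wpM2l (ltW l0) es)).
(* The factor [(ell_ j)^-1] in the minimum defining [epsj] absorbs [ell_ j]. *)
rewrite /epsj mulrA ger_pMl //; apply: (@le_trans _ _ (ell_ j * (ell_ j)^-1)).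
  by rewrite ler_pM2l // ge_min lexx.
by rewrite divff // gt_eqF.
Qed.

(** Each varying factor is replaced by its lower bound: [s * safe_step] for [tau_ j], [Lmin] for
    [ell_ j], and [Num.min Lmax^-1 1] for the ratio of [epsj] to [eps]. *)
Definition progress_rate : R :=
  c * (s * safe_step) * Lmin * (1 - 2 * (beta1 * kappa ^+ 2 + beta2))
  * Num.min Lmax^-1 1 ^+ 2 / (2 * kappa ^+ 2).

(** Cost of one unit of [chi_ j], with [tau_ j] bounded by 1 and [ell_ j] by [Lmax]. *)
Definition slack_rate : R := c * Lmax / kappa ^+ 2.

Lemma progress_rate_gt0 : 0 < progress_rate.
Proof.
have [_ [/andP[c0 _] [/andP[s0 _] [/andP[L0 L1] [k0 [_ [_ [d1 _]]]]]]]] := hP.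
have Lm : 0 < Lmax by exact: lt_le_trans L1.
have ss := safe_step_gt0.
have m0 : 0 < Num.min Lmax^-1 1 by rewrite lt_min ltr01 invr_gt0 Lm.
by rewrite divr_gt0 ?mulr_gt0 ?exprn_gt0 ?subr_gt0.
Qed.

Lemma progress j i : M (x_ j) -> step j -> ~ stops P eps tr j ->
  line_search f h g Retr P eps tr j i -> tau_ j = s ^+ i ->
  x_ j.+1 = Retr (x_ j) (tau_ j *: eta_ j) ->
  F (x_ j.+1) + progress_rate * eps ^+ 2 <=
    F (x_ j) + tau_ j * mu_ j + slack_rate * chi_ j.
Proof.
move=> Mx hj hns hl taui ->.
have tlow := line_search_lower_bound Mx hj hl; rewrite -taui in tlow.
have [hd _] := hl; rewrite -taui in hd.
have [/andP[Ll lL] [_ [_ [_ [_ [_ [_ [chi0 _]]]]]]]] := hj.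
have [_ [/andP[c0 _] [/andP[s0 s1] [/andP[L0 L1] [k0 [b10 [b20 [d1 _]]]]]]]] := hP.
have Lm : 0 < Lmax by exact: lt_le_trans L1.
have ss := safe_step_gt0.
have tau1 : tau_ j <= 1 by rewrite taui exprn_ile1 // ltW.
have l0 : 0 < ell_ j by exact: lt_le_trans Ll.
have tau0 : 0 < tau_ j by rewrite taui exprn_gt0.
move: hns => /negP; rewrite -ltNge /errj.
have w0 : 0 <= chi_ j + beta2 * epsj eps tr j ^+ 2.
  by rewrite addr_ge0 // mulr_ge0 // sqr_ge0.
set r := Num.sqrt _.
have rE : r ^+ 2 = chi_ j + beta2 * epsj eps tr j ^+ 2 by rewrite sqr_sqrtr.
have m0 : 0 < Num.min Lmax^-1 1 * eps by rewrite mulr_gt0 // lt_min ltr01 invr_gt0 Lm.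
have em : Num.min Lmax^-1 1 * eps <= epsj eps tr j.
  rewrite /epsj ler_pM2r // le_min !ge_min lexx orbT andbT.
  by rewrite lef_pV2 ?posrE ?lL.
have e0 : 0 < epsj eps tr j by exact: lt_le_trans em.
move=> hlt; have {hlt} : epsj eps tr j ^+ 2 < (kappa * `|eta_ j| + r) ^+ 2.
  by rewrite ltr_sqr ?nnegrE ?(ltW e0) // (le_trans _ (ltW hlt)) // ltW.
move=> hlt.
(* From [(u + r) ^+ 2 <= 2 * u ^+ 2 + 2 * r ^+ 2] with [u = kappa * `|eta_ j|]. *)
have {hlt} H : (1 - 2 * (beta1 * kappa ^+ 2 + beta2)) * epsj eps tr j ^+ 2 - 2 * chi_ j
     <= 2 * kappa ^+ 2 * (`|eta_ j| ^+ 2 - beta1 * epsj eps tr j ^+ 2).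
  have := sqr_ge0 (kappa * `|eta_ j| - r); move: hlt rE; lra.
have k2 : 0 < 2 * kappa ^+ 2 by rewrite mulr_gt0 // exprn_gt0.
(* Multiplied by [K], the right side of [H] becomes the decrease guaranteed by the line search,
   apart from [tau_ j * mu_ j]. *)
pose K := c * tau_ j * ell_ j / (2 * kappa ^+ 2).
have K0 : 0 <= K by rewrite ltW // divr_gt0 // !mulr_gt0.
have {H} := ler_wpM2l K0 H.
rewrite [X in _ <= X](mulrA K) [K * (2 * _)]divfK ?gt_eqF // mulrBr => H.
have H1 : progress_rate * eps ^+ 2 <=
    K * ((1 - 2 * (beta1 * kappa ^+ 2 + beta2)) * epsj eps tr j ^+ 2).
  have -> : progress_rate * eps ^+ 2 = (c * (s * safe_step) * Lmin / (2 * kappa ^+ 2)) *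
     ((1 - 2 * (beta1 * kappa ^+ 2 + beta2)) * (Num.min Lmax^-1 1 * eps) ^+ 2).
    by rewrite /progress_rate exprMn; ring.
  apply: ler_pM.
  - by rewrite ltW // divr_gt0 // !mulr_gt0.
  - by rewrite mulr_ge0 ?sqr_ge0 // ltW // subr_gt0.
  - rewrite ler_pM2r ?invr_gt0 //; apply: ler_pM => //; last by rewrite ler_pM2l.
      by apply: ltW; rewrite !mulr_gt0.
    exact: ltW.
  - by rewrite ler_pM2l ?subr_gt0 // ler_sqr ?nnegrE // ltW.
have H2 : K * (2 * chi_ j) <= slack_rate * chi_ j.
  rewrite mulrA ler_wpM2r //.
  have -> : K * 2 = c * tau_ j * ell_ j / kappa ^+ 2.
    by rewrite /K; field; rewrite gt_eqF.
  rewrite ler_pM2r ?invr_gt0 ?exprn_gt0 // -mulrA ler_pM2l //.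
  apply: le_trans lL; rewrite ger_pMl //.
move: hd; rewrite /decrease; move: H H1 H2; lra.
Qed.

Hypothesis hrun : irpdc_run dot M f h g Retr P eps tr x0.
Hypothesis hx0 : M x0.

(** Telescoping of [progress]. Feasibility is carried along in the induction, because
    [line_search_exists] needs it before the run determines the next iterate. *)
Lemma run_progress J : reached P eps tr J ->
  M (x_ J) /\ F (x_ J) + J%:R * (progress_rate * eps ^+ 2) <=
    F x0 + \sum_(0 <= t < J) tau_ t * mu_ t + slack_rate * \sum_(0 <= t < J) chi_ t.
Proof.
have [x0E [hstep hnext]] := hrun.
elim: J => [_|J IH hJ].
  by rewrite x0E !big_nil; split => //; rewrite mul0r mulr0 !addr0.
have rJ : reached P eps tr J by move=> i iJ; apply: hJ; exact: ltnW.
have nJ : ~ stops P eps tr J by exact: hJ.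
have [Mx IHJ] := IH rJ; have hj := hstep J rJ.
have [i hi] := line_search_exists Mx hj.
have [taui xJ] := hnext J rJ nJ i hi.
have := progress Mx hj nJ hi taui xJ.
split.
  rewrite xJ; have [+ _ _ _ _] := hRetr Mx; apply.
  have [_ _ TZ] := TM Mx; apply: TZ.
  by have [_ [_ [_ [Teta _]]]] := hj.
rewrite !big_nat_recr //= -natr1; move: IHJ; lra.
Qed.

End Run.
End Method.

(** For [e <= 1] the rounding term 1 is at most [e ^- 2], whence the constant [K + 1]. *)
Lemma truncn_bigO_sq (R : realType) (K : R) : 0 <= K ->
  (fun eps : R => (Num.truncn (K / eps ^+ 2)).+1%:R : R) =O_ (0^'+)
    (fun eps : R => eps ^- 2).
Proof.
move=> K0; apply/eqO_exP; exists (K + 1); first by rewrite ltr_wpDl.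
near=> e.
have e0 : 0 < e by near: e; exact: nbhs_right_gt.
have e1 : e <= 1 by near: e; apply: nbhs_right_le.
have e2 : 0 < e ^+ 2 by rewrite exprn_gt0.
rewrite !ger0_norm ?invr_ge0 ?(ltW e2) // -natr1 mulrDl mul1r lerD //.
  by have /andP[] := truncn_itv (divr_ge0 K0 (ltW e2)).
by rewrite invf_ge1 // exprn_ile1 // ltW.
Unshelve. all: by end_near. Qed.

Theorem theorem4p4 (R : realType) (E : normedModType R)
    (dot : {dot E for idfun}) (n d : nat) (M : set E)
    (f h g : E -> R) (Lf0 Lf Lh0 Lg0 Fbar : R)
    (Retr : E -> E -> E) (iota1 iota2 : R)
    (P : irpdc_params R) (x0 : E)
    (hE : euclidean_space dot n)
    (hM : submanifold n d M)
    (hL : [/\ 0 <= Lf0, 0 <= Lf, 0 <= Lh0 & 0 <= Lg0])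
    (hf : C_on 1 setT f)
    (hf0 : Lf0.-lipschitz f)
    (hfL : forall x y : E,
       f y <= f x + dot (gradient dot f x) (y - x) + Lf / 2 * `|y - x| ^+ 2)
    (hh : convex_function setT h)
    (hh0 : Lh0.-lipschitz h)
    (hg : convex_function setT g)
    (hg0 : Lg0.-lipschitz g)
    (hF : compact [set x | M x /\ objective f h g x <= Fbar])
    (hiota : 0 < iota1 /\ 0 < iota2)
    (hRetr : retraction M Retr iota1 iota2)
    (hx0 : M x0)
    (hP : valid_params P) :
  exists N : R -> nat,
    (fun eps : R => (N eps)%:R : R) =O_ (0^'+) (fun eps : R => eps ^- 2) /\
    forall eps : R, 0 < eps ->
    forall tr : irpdc_trace E,
      irpdc_run dot M f h g Retr P eps tr x0 ->
      (forall j, reached P eps tr j.+1 ->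
         \sum_(0 <= t < j.+1) t_tau tr t * t_mu tr t <= p_mu P) ->
      (* [J.+1] iterations (of index 0 to J) are performed *)
      exists J : nat,
        [/\ (J.+1 <= N eps)%N,
            forall j, (j < J)%N ->
              exists i, line_search f h g Retr P eps tr j i,
            reached P eps tr J,
            stops P eps tr J &
            critical_point dot M f h g eps (t_x tr J)].
Proof.
have [dotE _] := hE; have [l lE] := euclidean_spanned hE.
have TM x : M x -> is_subspace (tangent M x) by exact: tangent_subspace hM.
have fD x : differentiable f x by have [+ _] := hf; apply.
have [Lf00 Lf_0 Lh00 Lg00] := hL.
have [Fmin HF] := objective_bounded_below hf0 hh0 hg0 Lf00 Lh00 Lg00 hF.
pose A := progress_rate Lf0 Lf Lh0 Lg0 iota1 iota2 P.
have A0 : 0 < A by exact: progress_rate_gt0.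
have [_ [/andP[c0 _] [_ [/andP[L0 L1] [k0 [_ [_ [_ [mu0 chi0]]]]]]]]] := hP.
have B0 : 0 <= slack_rate P.
  by rewrite divr_ge0 ?sqr_ge0 // mulr_ge0 ?(ltW c0) // ltW // (lt_le_trans L0).
(* Total budget of a run: initial gap plus the bounds on the accumulated slack. Each iteration that
   does not stop uses at least [A * eps ^+ 2] of it. *)
pose D := objective f h g x0 - Fmin + p_mu P + slack_rate P * p_chi P.
have D0 : 0 <= D.
  have := HF _ hx0; have := mulr_ge0 B0 (ltW chi0); rewrite /D; lra.
exists (fun eps => (Num.truncn (D / A / eps ^+ 2)).+1); split.
  by apply: truncn_bigO_sq; rewrite divr_ge0 // ltW.
move=> eps eps0 tr hrun hmu.
set K := (Num.truncn _).+1.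
have [x0E [hstep hnext]] := hrun.
have rp J (rJ : reached P eps tr J) :=
  run_progress lE TM hL fD hf0 hfL hh hh0 hg0 hiota hRetr hP eps0 hrun hx0 rJ.
have [J [JK hs] Jmin] : exists2 J, (J < K)%N /\ stops P eps tr J &
    forall k, (k < J)%N -> ~ stops P eps tr k.
  have [|J [[JK hs] Jmin]] := @nat_least (fun J => (J < K)%N /\ stops P eps tr J).
    (* If none of the first [K] tests stops, the run spends [K%:R * (A * eps ^+ 2)], which exceeds
       [D] since [K] is the successor of a truncation. *)
    apply: contrapT => /forallNP H.
    have rK : reached P eps tr K by move=> i iK si; apply: (H i).
    have [Mx HK] := rp K rK.
    have H1 := hmu _ rK.
    (* Condition (d) at index [K.-1] bounds the sum of [chi] over exactly the first [K] indices. *)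
    have [_ [_ [_ [_ [_ [_ [_ [_ H2]]]]]]]] : step12 dot M f h g P eps tr K.-1.
      by apply: hstep => i iK; apply: rK; exact: leqW.
    have := HF _ Mx; have := ler_wpM2l B0 H2.
    have Ae0 : 0 < A * eps ^+ 2 by rewrite mulr_gt0 // exprn_gt0.
    have : D < K%:R * (A * eps ^+ 2).
      rewrite -ltr_pdivrMr // invfM mulrA; exact: truncnS_gt.
    rewrite /D; move: HK H1; rewrite -/A; lra.
  exists J => // k kJ sk; apply: (Jmin _ kJ); split => //; exact: ltn_trans JK.
have rJ k : (k <= J)%N -> reached P eps tr k.
  by move=> kJ i ik; apply: Jmin; exact: leq_trans kJ.
exists J; split => //.
- move=> j jJ; have rj := rJ j (ltnW jJ).
  have [Mx _] := rp j rj.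
  exact: (line_search_exists lE TM hL fD hf0 hfL hh hh0 hg0 hiota hRetr hP Mx
            (hstep j rj)).
- have [Mx _] := rp J (rJ J (leqnn J)).
  by apply: (stop_critical dotE lE TM hh hP) => //; apply: hstep; exact: rJ.
Qed.
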